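(* Let $\{f_i\}_{i=1}^\infty$ be a frame for the separable Hilbert space $\mathcal H$, let $U : l^2(\mathbf N)\to l^2(\mathbf N)$ be a bounded operator with matrix $\{u_{i,j}\}_{i,j\in\mathbf N}$, and define $g_i=\sum_{j=1}^\infty u_{i,j}f_j$ for $i\in\mathbf N$. Then $\{g_i\}_{i=1}^\infty$ is a Riesz basis if and only if $\overline U : R_{T^*}\to l^2(\mathbf N)$ is surjective.
   Context: A family $\{f_i\}_{i=1}^\infty$ in a separable Hilbert space $\mathcal H$ is a frame for $\mathcal H$ if there are $A,B>0$ with $A\|f\|^2\le\sum_i|\langle f,f_i\rangle|^2\le B\|f\|^2$ for all $f\in\mathcal H$. The inner product is linear in the first entry. A Riesz basis is a family of elements of $\mathcal H$ which is the image of an orthonormal basis under a bounded invertible operator. The pre-frame operator of $\{f_i\}_{i=1}^\infty$ is the bounded operator $T:l^2(\mathbf N)\to\mathcal H$, $T\{c_i\}=\sum_i c_if_i$, with adjoint $T^*f=\{\langle f,f_i\rangle\}_{i=1}^\infty$; $R_{T^*}$ denotes the range of $T^*$. The matrix of $U$ is taken with respect to the canonical orthonormal basis of $l^2(\mathbf N)$, so $(U\{c_j\})_i=\sum_j u_{i,j}c_j$, and $\overline U$ is the operator on $l^2(\mathbf N)$ whose matrix $\{\overline{u_{i,j}}\}$ is the entrywise complex conjugate of that of $U$. The map $\overline U : R_{T^*}\to l^2(\mathbf N)$ is the restriction of $\overline U$ to $R_{T^*}$.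
   Formalization: ''Riesz basis'' is taken to mean a Riesz basis of its closed linear span, not necessarily of all of H; otherwise the claim fails, e.g. for f_i = e_i in l^2 and U the left shift, where the conjugate of U is surjective but g_i = e_{i+1} does not span H. *)

(* Defs.v *)
From HB Require Import structures.
From mathcomp Require Import all_boot all_order all_algebra.
From mathcomp Require Import complex lra.
From mathcomp Require Import boolp classical_sets functions cardinality reals ereal.
From mathcomp Require Import topology normedtype sequences.

Set Implicit Arguments.
Unset Strict Implicit.
Unset Printing Implicit Defensive.

Import Order.TTheory GRing.Theory Num.Theory.
Import numFieldNormedType.Exports.

Local Open Scope classical_set_scope.
Local Open Scope ring_scope.

(* The norm of a normed module over [R[i]] takes its values in [R[i]];
   [rnorm] is that norm as an element of [R]. *)
Definition rnorm (R : realType) (V : normedZmodType R[i]) (x : V) : R :=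
  complex.Re `|x|.

Section rnorm_theory.
Variable R : realType.
Local Notation C := R[i].
Local Notation toC := (real_complex R).

Lemma rnormE (V : normedZmodType C) (x : V) : toC (rnorm x) = `|x|.
Proof. by rewrite RRe_real// normr_real. Qed.

Lemma rnorm_ge0 (V : normedZmodType C) (x : V) : 0 <= rnorm x.
Proof. by rewrite -lecR rnormE normr_ge0. Qed.

Lemma rnorm0 (V : normedZmodType C) : rnorm (0 : V) = 0.
Proof. by apply: complexI; rewrite rnormE normr0. Qed.

Lemma rnormN (V : normedZmodType C) (x : V) : rnorm (- x) = rnorm x.
Proof. by rewrite /rnorm normrN. Qed.

Lemma rnormD (V : normedZmodType C) (x y : V) :
  rnorm (x + y) <= rnorm x + rnorm y.
Proof. by rewrite -lecR rmorphD/= !rnormE ler_normD. Qed.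

Lemma rnorm_dist (V : normedZmodType C) (x y : V) :
  `|rnorm x - rnorm y| <= rnorm (x - y).
Proof.
apply/ler_normlP; rewrite opprB; split; rewrite lerBlDr.
  by rewrite -[in leRHS]rnormN opprB (le_trans _ (rnormD _ _))// subrK.
by rewrite (le_trans _ (rnormD _ _))// subrK.
Qed.

Lemma rnormM (x y : C) : rnorm (x * y) = rnorm x * rnorm y.
Proof. by apply: complexI; rewrite rmorphM/= !rnormE normrM. Qed.

Lemma rnormJ (x : C) : rnorm x^* = rnorm x.
Proof. by rewrite /rnorm norm_conjC. Qed.

Lemma rnorm_sqr (x : C) : toC (rnorm x ^+ 2) = x * x^*.
Proof. by rewrite rmorphXn/= rnormE normCK. Qed.

Lemma rnorm_ge_Re (z : C) : `|complex.Re z| <= rnorm z.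
Proof. by rewrite -lecR rnormE normc_ge_Re. Qed.

Lemma rnorm_ge_Im (z : C) : `|complex.Im z| <= rnorm z.
Proof. by rewrite -lecR rnormE normc_def lecR -sqrtr_sqr ler_wsqrtr// lerDr sqr_ge0. Qed.

Lemma rnorm_le_ReIm (z : C) :
  rnorm z <= `|complex.Re z| + `|complex.Im z|.
Proof.
rewrite -lecR rnormE {1}[z]complexE (le_trans (ler_normD _ _))//.
rewrite normrM !normc_def/=.
by rewrite !expr0n/= !addr0 !expr1n add0r sqrtr1 mul1r !sqrtr_sqr -rmorphD.
Qed.

Lemma ReK_gt0 (e : C) : 0 < e -> toC (complex.Re e) = e /\ 0 < complex.Re e.
Proof.
move=> e0; have er : toC (complex.Re e) = e by rewrite RRe_real// gtr0_real.
by split=> //; rewrite -ltcR er.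
Qed.

Lemma complex_cauchy_cvg (F : set_system C^o) :
  ProperFilter F -> cauchy F -> cvg F.
Proof.
move=> FF /cauchy_ballP cF.
have part (p : C -> R) : {morph p : x y / x - y} ->
    (forall z, `|p z| <= rnorm z) -> cvg (p @ F).
  move=> pB ple; apply: cauchy_cvg; apply/cauchy_ballP => e e0.
  have e0' : 0 < toC e :> C by rewrite (_ : 0 = toC 0)// ltcR.
  rewrite near_map2; apply: filterS (cF _ e0') => -[x y]/=.
  rewrite -!ball_normE /= -pB => xy.
  by rewrite (le_lt_trans (ple _))// -ltcR rnormE.
have /cvg_ex[a ca] :=
  part (@complex.Re R) ltac:(by move=> [? ?] [? ?]) rnorm_ge_Re.
have /cvg_ex[b cb] :=
  part (@complex.Im R) ltac:(by move=> [? ?] [? ?]) rnorm_ge_Im.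
apply/cvg_ex; exists (Complex a b : C^o).
apply/(@cvgrPdist_lt _ C^o) => e /ReK_gt0[er re0].
move/cvgrPdist_lt : ca => /(_ (complex.Re e / 2)) ca.
move/cvgrPdist_lt : cb => /(_ (complex.Re e / 2)) cb.
have {}ca := ca ltac:(by rewrite divr_gt0).
have {}cb := cb ltac:(by rewrite divr_gt0).
near=> z.
rewrite -er -rnormE ltcR (le_lt_trans (rnorm_le_ReIm _))//.
rewrite [ltRHS]splitr ltrD//.
  suff -> : complex.Re (Complex a b - z) = a - complex.Re z by near: z; exact: ca.
  by case: (z).
suff -> : complex.Im (Complex a b - z) = b - complex.Im z by near: z; exact: cb.
by case: (z).
Unshelve. all: by end_near. Qed.

Lemma cvg_complex_series (d : nat -> C^o) (M : R) :
  (forall n, \sum_(0 <= i < n) rnorm (d i) <= M) -> cvgn (series d).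
Proof.
move=> dM; apply: complex_cauchy_cvg; apply/cauchy_seriesP => e /ReK_gt0[er e0].
have : cvgn (series (fun i => rnorm (d i))).
  apply: nondecreasing_is_cvgn.
    by apply: nondecreasing_series => i _ _; exact: rnorm_ge0.
  by exists M => _ [n _ <-]; exact: dM.
move=> /cauchy_cvgP/cauchy_seriesP/(_ _ e0).
apply: filterS => -[m n]/=.
rewrite -ltcR er; apply: le_lt_trans.
rewrite (le_trans (ler_norm_sum _ _ _))// ger0_norm; last first.
  by apply: sumr_ge0 => i _; exact: rnorm_ge0.
by rewrite rmorph_sum/= ler_sum// => i _; rewrite rnormE.
Qed.

Lemma conj_cvg (d : nat -> C^o) (l : C^o) :
  d @ \oo --> l -> (fun n => (d n)^* : C^o) @ \oo --> (l^* : C^o).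
Proof.
move=> /cvgrPdist_lt dl; apply/cvgrPdist_lt => e /dl; apply: filterS => n.
by rewrite -rmorphB norm_conjC.
Qed.

End rnorm_theory.

Section dot_theory.
Variables (C : numClosedFieldType) (U : lmodType C).
Variable form : {dot U for @Num.conj C}.
Local Notation "''[' u , v ]" := (form u v) : ring_scope.

Lemma dot_cauchy_schwarz u v : `|'[u, v]| ^+ 2 <= '[u, u] * '[v, v].
Proof.
have [->|v0] := eqVneq v 0; first by rewrite !linear0r normr0 expr0n mulr0.
have vv0 : 0 < '[v, v] by rewrite dnorm_gt0.
have vvJ : '[v, v]^* = '[v, v] by rewrite geC0_conj// ltW.
have := dnorm_ge0 form (u - ('[u, v] / '[v, v]) *: v).
rewrite dnormB /= dnormZ linearZr_LR /=.
rewrite normrM exprMn normfV (ger0_norm (ltW vv0)) rmorphM fmorphV/= vvJ.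
set a := '[u, v]; set b := '[v, v] in vv0 vvJ *.
have -> : a^* / b * a = `|a| ^+ 2 / b by rewrite normCK mulrAC [a * _]mulrC.
have -> : (`|a| ^+ 2 / b)^* = `|a| ^+ 2 / b.
  by rewrite rmorphM fmorphV/= vvJ rmorphXn/= (geC0_conj (normr_ge0 _)).
have -> : `|a| ^+ 2 * b^-1 ^+ 2 * b = `|a| ^+ 2 / b.
  by rewrite expr2 !mulrA divfK// gt_eqF.
by rewrite opprD addrA addrK subr_ge0 ler_pdivrMr.
Qed.

Lemma dot_triangle u v :
  sqrtC '[u + v, u + v] <= sqrtC '[u, u] + sqrtC '[v, v].
Proof.
have uu := dnorm_ge0 form u; have vv := dnorm_ge0 form v.
rewrite -ler_sqr ?nnegrE ?addr_ge0 ?sqrtC_ge0 ?dnorm_ge0//.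
rewrite sqrrD !sqrtCK dnormD/= [leRHS]addrAC lerD2l.
have -> : '[u, v] + '[u, v]^* = 'Re '[u, v] *+ 2.
  by rewrite ReE -mulr_natr -mulrA mulVf ?mulr1// pnatr_eq0.
rewrite lerMn2r/= (le_trans (leif_Re_Creal _))//.
rewrite -sqrtCM ?nnegrE// -[leLHS]sqrCK// ler_sqrtC ?nnegrE ?mulr_ge0 ?exprn_ge0//.
exact: dot_cauchy_schwarz.
Qed.

End dot_theory.

(* [hdot] is linear in its first argument and conjugate-linear in its second. *)
HB.mixin Record CompleteNormedModule_isHilbert (R : realType) H
    & CompleteNormedModule R[i] H := {
  hdot : {dot H for @Num.conj R[i]};
  hdotE : forall x, hdot x x = `|x| ^+ 2
}.

#[short(type="hilbertType")]
HB.structure Definition Hilbert (R : realType) :=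
  {H of CompleteNormedModule R[i] H & CompleteNormedModule_isHilbert R H}.

Arguments hdot {R s}.

Definition square_summable (R : realType) (c : nat -> R[i]) : Prop :=
  (\sum_(0 <= i <oo) ((rnorm (c i)) ^+ 2)%:E < +oo)%E.

Section square_summable_theory.
Variable R : realType.
Local Notation C := R[i].

Lemma square_summableP (c : nat -> C) : square_summable c <->
  exists M : R, forall n, \sum_(0 <= i < n) rnorm (c i) ^+ 2 <= M.
Proof.
have c0 i : (0 <= ((rnorm (c i)) ^+ 2)%:E)%E by rewrite lee_fin exprn_ge0// rnorm_ge0.
split=> [cfin|[M cM]].
  exists (fine (\sum_(0 <= i <oo) ((rnorm (c i)) ^+ 2)%:E)) => n.
  rewrite -lee_fin fineK; last by rewrite ge0_fin_numE// nneseries_ge0.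
  by rewrite -sumEFin; exact: nneseries_lim_ge.
rewrite /square_summable (le_lt_trans _ (ltry M))//.
apply: lime_le; first exact: is_cvg_nneseries.
by apply: nearW => n; rewrite sumEFin lee_fin.
Qed.

Lemma toC_cvg (u : nat -> R) (l : R) :
  u @ \oo --> l -> (fun n => real_complex R (u n) : C^o) @ \oo -->
    (real_complex R l : C^o).
Proof.
move=> /cvgrPdist_lt ul; apply/cvgrPdist_lt => e /ReK_gt0[er e0].
apply: filterS (ul _ e0) => n; rewrite -[e]er -rmorphB normc_def/= expr0n/= addr0.
by rewrite sqrtr_sqr ltcR.
Qed.

Lemma square_summableD (a : C) (c d : nat -> C) :
  square_summable c -> square_summable d ->
  square_summable (fun i => a * c i + d i).
Proof.
move=> /square_summableP[M cM] /square_summableP[N dN].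
apply/square_summableP; exists (2 * rnorm a ^+ 2 * M + 2 * N) => n.
apply: (@le_trans _ _ (\sum_(0 <= i < n)
    (2 * rnorm a ^+ 2 * rnorm (c i) ^+ 2 + 2 * rnorm (d i) ^+ 2))).
  apply: ler_sum => i _.
  have := rnormD (a * c i) (d i); rewrite rnormM.
  have := rnorm_ge0 (a * c i + d i).
  move: (rnorm (a * c i + d i)) (rnorm a) (rnorm (c i)) (rnorm (d i)) => x p q r.
  move=> x0 xpqr; apply: (@le_trans _ _ ((p * q + r) ^+ 2)).
    by rewrite ler_sqr ?nnegrE// (le_trans x0).
  have := sqr_ge0 (p * q - r); nra.
by rewrite big_split/= -!mulr_sumr lerD ?ler_wpM2l ?mulr_ge0 ?exprn_ge0 ?rnorm_ge0.
Qed.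

Lemma cvg_dot (c d : nat -> C) : square_summable c -> square_summable d ->
  cvgn (series (fun i => c i * (d i)^* : C^o)).
Proof.
move=> /square_summableP[M cM] /square_summableP[N dN].
apply: (@cvg_complex_series _ _ (M + N)) => n.
apply: (@le_trans _ _ (\sum_(0 <= i < n) (rnorm (c i) ^+ 2 + rnorm (d i) ^+ 2))).
  apply: ler_sum => i _; rewrite rnormM rnormJ.
  move: (rnorm (c i)) (rnorm (d i)) (rnorm_ge0 (c i)) (rnorm_ge0 (d i)) => p q *.
  by have := sqr_ge0 (p - q); nra.
by rewrite big_split/= lerD.
Qed.

Lemma square_summable_cvg (c : nat -> C) : square_summable c ->
  cvgn (series (fun i => rnorm (c i) ^+ 2)).
Proof.
move=> /square_summableP[M cM]; apply: nondecreasing_is_cvgn.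
  by apply: nondecreasing_series => i _ _; rewrite exprn_ge0// rnorm_ge0.
by exists M => _ [n _ <-]; exact: cM.
Qed.

End square_summable_theory.

Definition l2_pred (R : realType) : {pred nat -> R[i]} :=
  fun c => `[< square_summable c >].

Section l2_submod.
Variable R : realType.

Let l2_submod_closed : submod_closed (@l2_pred R).
Proof.
split=> [|a c d /asboolP cs /asboolP ds]; apply/asboolP; last exact: square_summableD.
apply/square_summableP; exists 0 => n; rewrite big1// => i _.
by rewrite [X in rnorm X](_ : _ = 0)// rnorm0 expr0n.
Qed.

HB.instance Definition _ := GRing.isSubmodClosed.Build R[i] (nat -> R[i])
  (@l2_pred R) l2_submod_closed.

End l2_submod.

Record l2 (R : realType) := L2 {
  l2seq :> nat -> R[i];
  l2seq_subproof : l2seq \in @l2_pred R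
}.

HB.instance Definition _ (R : realType) := [isSub for @l2seq R].
HB.instance Definition _ (R : realType) := [Choice of l2 R by <:].
HB.instance Definition _ (R : realType) := [SubChoice_isSubLmodule of l2 R by <:].

Section l2_hilbert.
Variable R : realType.
Local Notation C := R[i].
Local Notation toC := (real_complex R).
Implicit Types c d : l2 R.

Definition mkl2 (c : nat -> C) (cs : square_summable c) : l2 R := L2 (asboolT cs).

Lemma l2P c : square_summable c.
Proof. by apply/asboolP; exact: (l2seq_subproof c). Qed.

Lemma l2D c d i : (c + d) i = c i + d i. Proof. by []. Qed.
Lemma l2N c i : (- c) i = - c i. Proof. by []. Qed.
Lemma l2Z a c i : (a *: c) i = a * c i. Proof. by []. Qed.
Lemma l2_0 i : (0 : l2 R) i = 0. Proof. by []. Qed.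
Lemma l2_ext c d : c =1 d -> c = d.
Proof. by move=> cd; apply/val_inj/funext. Qed.

Definition l2dot c d : C := limn (series (fun i => c i * (d i)^* : C^o)).

Lemma l2dot_cvg c d :
  series (fun i => c i * (d i)^* : C^o) @ \oo --> (l2dot c d : C^o).
Proof. exact: cvg_dot (l2P c) (l2P d). Qed.

Lemma l2dot_herm c d : l2dot c d = (-1) ^+ false * (l2dot d c)^*.
Proof.
rewrite expr0 mul1r; apply/(@cvg_lim C^o) => //.
have := conj_cvg (@l2dot_cvg d c); apply: cvg_trans; apply: near_eq_cvg.
apply: nearW => n; rewrite /series/= rmorph_sum/=; apply: eq_bigr => i _.
by rewrite rmorphM/= conjCK mulrC.
Qed.

Lemma l2dot_linear d : GRing.linear_for *%R (l2dot^~ d).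
Proof.
move=> a c1 c2; apply/(@cvg_lim C^o) => //.
have h1 := @cvgZl_tmp _ C^o _ _ _ a _ _ (@l2dot_cvg c1 d).
have h := cvgD (h1 _) (@l2dot_cvg c2 d).
apply: cvg_trans (h _ _); apply: near_eq_cvg; apply: nearW => n /=.
rewrite /series /= fctE/= scaler_sumr -big_split/=; apply: eq_bigr => i _.
transitivity ((a * c1 i + c2 i) * (d i)^*); last by [].
by rewrite mulrDl -mulrA.
Qed.


Let l2dot_zmodl d : zmod_morphism (l2dot^~ d).
Proof.
by move=> c1 c2; rewrite addrC -scaleN1r l2dot_linear mulN1r addrC.
Qed.

Let l2dot_scalel d : scalable_for *%R (l2dot^~ d).
Proof.
move=> a c; have := l2dot_linear d a c 0.
by rewrite addr0 (_ : l2dot 0 d = 0) ?addr0// -[X in l2dot X d](subrr 0) l2dot_zmodl subrr.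
Qed.

Let l2dot_zmodr c : zmod_morphism (l2dot c).
Proof.
move=> d1 d2; rewrite l2dot_herm l2dot_zmodl expr0 mul1r rmorphB/=.
by rewrite [l2dot c d1]l2dot_herm [l2dot c d2]l2dot_herm expr0 !mul1r.
Qed.

Let l2dot_scaler c : scalable_for (@Num.conj C \; *%R) (l2dot c).
Proof.
move=> a d; rewrite l2dot_herm l2dot_scalel expr0 mul1r rmorphM/=.
by rewrite [l2dot c d]l2dot_herm expr0 mul1r.
Qed.

HB.instance Definition _ := isBilinear.Build C (l2 R) (l2 R) C *%R
  (@Num.conj C \; *%R) l2dot l2dot_zmodl l2dot_zmodr l2dot_scalel l2dot_scaler.

HB.instance Definition _ := isHermitianSesquilinear.Build C (l2 R) false
  (@Num.conj C) l2dot l2dot_herm.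


Lemma l2dotE c : l2dot c c = toC (limn (series (fun i => rnorm (c i) ^+ 2))).
Proof.
apply/(@cvg_lim C^o) => //.
rewrite (_ : series _ =
    (fun m => toC (series (fun i => rnorm (c i) ^+ 2) m) : C^o)); last first.
  apply/funext => m; rewrite /series/= rmorph_sum/=.
  by apply: eq_bigr => i _; rewrite rnorm_sqr.
by apply: toC_cvg; exact: square_summable_cvg (l2P c).
Qed.

Lemma l2dot_ge c n : toC (\sum_(0 <= i < n) rnorm (c i) ^+ 2) <= l2dot c c.
Proof.
rewrite l2dotE lecR.
apply: (@nondecreasing_cvgn_le _ (series (fun i => rnorm (c i) ^+ 2))).
  by apply: nondecreasing_series => i _ _; rewrite exprn_ge0// rnorm_ge0.
exact: square_summable_cvg (l2P c).
Qed.

Lemma l2dot_le c (M : R) :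
  (forall n, \sum_(0 <= i < n) rnorm (c i) ^+ 2 <= M) -> l2dot c c <= toC M.
Proof.
move=> cM; rewrite l2dotE lecR; apply: limr_le.
  exact: square_summable_cvg (l2P c).
by apply: nearW => n; exact: cM.
Qed.

Let l2dot_gt0 c : c != 0 -> 0 < l2dot c c.
Proof.
move=> c0; have [i ci0] : exists i, c i != 0.
  apply: contrapT => /forallNP h; move/eqP: c0; apply; apply: l2_ext => i.
  by apply/eqP; rewrite -[_ == _]negbK; apply/negP/h.
apply: lt_le_trans (l2dot_ge c i.+1).
rewrite (_ : 0 = toC 0)// ltcR big_nat_recr//= ltr_pwDr//.
  by rewrite exprn_gt0// lt_def rnorm_ge0 -(inj_eq (@complexI _)) rnormE normr_eq0 ci0.
by apply: sumr_ge0 => j _; rewrite exprn_ge0// rnorm_ge0.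
Qed.

HB.instance Definition _ := isDotProduct.Build C (l2 R) l2dot l2dot_gt0.

Definition l2norm c : C := sqrtC (l2dot c c).

Let l2normD c d : l2norm (c + d) <= l2norm c + l2norm d.
Proof. exact: (@dot_triangle _ _ l2dot). Qed.

Let l2normZ a c : l2norm (a *: c) = `|a| * l2norm c.
Proof.
rewrite /l2norm (@dnormZ _ _ l2dot) sqrtCM ?nnegrE ?exprn_ge0//.
by rewrite sqrCK.
Qed.

Let l2norm_eq0 c : l2norm c = 0 -> c = 0.
Proof. by move=> /eqP; rewrite sqrtC_eq0 (@dnorm_eq0 _ _ l2dot) => /eqP. Qed.

HB.instance Definition _ :=
  Lmodule_isNormed.Build C (l2 R) l2normD l2normZ l2norm_eq0.

Lemma l2normE c : `|c| = sqrtC (l2dot c c). Proof. by []. Qed.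

Lemma l2norm_sqr c : `|c| ^+ 2 = l2dot c c.
Proof. by rewrite l2normE sqrtCK. Qed.

Lemma l2_rnorm_sqr c :
  rnorm c ^+ 2 = limn (series (fun i => rnorm (c i) ^+ 2)).
Proof. by apply: complexI; rewrite rmorphXn/= rnormE l2norm_sqr l2dotE. Qed.

Lemma l2_partial_le c n : \sum_(0 <= i < n) rnorm (c i) ^+ 2 <= rnorm c ^+ 2.
Proof. by rewrite -lecR rmorphXn/= rnormE l2norm_sqr; exact: l2dot_ge. Qed.

Lemma l2_norm_le c (M : R) : 0 <= M ->
  (forall n, \sum_(0 <= i < n) rnorm (c i) ^+ 2 <= M ^+ 2) -> rnorm c <= M.
Proof.
move=> M0 cM; rewrite -ler_sqr ?nnegrE ?rnorm_ge0//.
by rewrite -lecR rmorphXn/= rnormE l2norm_sqr; exact: l2dot_le.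
Qed.

Lemma l2_coord_le c i : rnorm (c i) <= rnorm c.
Proof.
rewrite -ler_sqr ?nnegrE ?rnorm_ge0// (le_trans _ (l2_partial_le c i.+1))//.
by rewrite big_nat_recr//= lerDr sumr_ge0// => j _; rewrite exprn_ge0// rnorm_ge0.
Qed.

Let l2_complete (F : set_system (l2 R)) : ProperFilter F -> cauchy F -> cvg F.
Proof.
move=> FF /cauchy_ballP cF.
have cF' (e : R) : 0 < e ->
    \forall x \near F & y \near F, rnorm (x - y) < e.
  move=> e0; have e0' : 0 < toC e :> C by rewrite (_ : 0 = toC 0)// ltcR.
  apply: filterS (cF _ e0') => -[x y]/=.
  by rewrite -ball_normE /= -ltcR rnormE.
have cvgi i : cvg ((fun x : l2 R => x i : C^o) @ F).
  apply: complex_cauchy_cvg; apply/cauchy_ballP => e /ReK_gt0[er e0].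
  rewrite near_map2; apply: filterS (cF' _ e0) => -[x y]/= xy.
  rewrite -ball_normE /= -rnormE -er ltcR (le_lt_trans _ xy)//.
  exact: (l2_coord_le (x - y) i).
pose l i : C := lim ((fun x : l2 R => x i : C^o) @ F).
have xl (e : R) : 0 < e -> F [set x : l2 R | forall n, \sum_(0 <= i < n) rnorm (x i - l i) ^+ 2 <= e ^+ 2].
  move=> e0; refine (filterS _ (nearP_dep (cF' _ e0))) => x xF n.
  have cx m : (fun y : l2 R => \sum_(0 <= i < m) rnorm (x i - y i) ^+ 2) @ F -->
      \sum_(0 <= i < m) rnorm (x i - l i) ^+ 2.
    elim: m => [|i IH].
      by under eq_fun do rewrite big_geq//; rewrite big_geq//; exact: cvg_cst.
    under eq_fun do rewrite big_nat_recr//=.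
    rewrite big_nat_recr//=; apply: cvgD => //.
    have ri : (fun y : l2 R => rnorm (x i - y i)) @ F --> rnorm (x i - l i).
      apply/cvgrPdist_lt => d d0.
      have := cvgi i => /(@cvgrPdist_lt _ C^o)/(_ (toC d)).
      have -> : 0 < toC d by rewrite (_ : 0 = toC 0)// ltcR.
      move=> /(_ isT); apply: filterS => y; rewrite -rnormE ltcR => yl.
      rewrite (le_lt_trans _ yl)// -/(l i).
      have := rnorm_dist (x i - y i : C) (x i - l i).
      by rewrite distrC opprB [X in _ <= rnorm X]addrC subrKA.
    by rewrite expr2; under eq_fun do rewrite expr2; exact: cvgM.
  apply: (closed_cvg _ (@closed_le _ (e ^+ 2)) _ _ (cx n)).
  apply: filterS xF => y xy; apply: le_trans (l2_partial_le (x - y) n) _.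
  by rewrite ler_sqr ?nnegrE ?rnorm_ge0 ?(ltW e0)//; exact: ltW.
have ls : square_summable l.
  have /filter_ex[x xl1] := xl 1 ltr01.
  have xls : square_summable (fun i => x i - l i) by apply/square_summableP; exists (1 ^+ 2).
  have := square_summableD (- 1) xls (l2P x).
  by congr square_summable; apply/funext => i; rewrite mulN1r opprB subrK.
apply/cvg_ex; exists (mkl2 ls).
apply/cvgrPdist_lt => e /ReK_gt0[er e0].
have e20 : 0 < complex.Re e / 2 by rewrite divr_gt0.
apply: filterS (xl _ e20) => x xle.
rewrite distrC -rnormE -er ltcR (le_lt_trans (@l2_norm_le (x - mkl2 ls) _ (ltW e20) xle))//.
by rewrite gtr_pMr// invf_lt1// ltr1n.
Qed.

HB.instance Definition _ := Uniform_isComplete.Build (l2 R) l2_complete.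

Let l2_hdotE c : l2dot c c = `|c| ^+ 2. Proof. by rewrite l2norm_sqr. Qed.

HB.instance Definition _ :=
  CompleteNormedModule_isHilbert.Build R (l2 R) l2_hdotE.

End l2_hilbert.

Section canonical_basis.
Variable R : realType.
Local Notation C := R[i].
Implicit Types c d : l2 R.

Let delta_summable j : square_summable (fun i => (i == j)%:R : C).
Proof.
apply/square_summableP; exists 1 => n.
apply: (@le_trans _ _ (\sum_(0 <= i < n) ((i == j)%:R : R))).
  apply: ler_sum => i _; rewrite -lecR rmorphXn/= rnormE normr_nat -natrX rmorph_nat.
  by rewrite ler_nat; case: eqP.
rewrite big_mkord; have [jn|nj] := ltnP j n.
  rewrite (bigD1 (Ordinal jn))//= eqxx big1 ?addr0// => i.
  by rewrite -val_eqE /= => /negbTE ->.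
by rewrite big1// => i _; rewrite ltn_eqF// (leq_trans _ nj).
Qed.

Definition l2delta j : l2 R := mkl2 (delta_summable j).

Lemma hdot_delta c j : hdot c (l2delta j) = c j.
Proof.
apply/(@cvg_lim C^o) => //; apply: cvg_near_cst; exists j.+1 => // n /= jn.
rewrite /series/= big_mkord (bigD1 (Ordinal jn))//= eqxx conjC1 mulr1.
rewrite big1 ?addr0// => i; rewrite -val_eqE /= => /negbTE ->.
by rewrite conjC0 mulr0.
Qed.

Lemma l2delta_orthonormal i j :
  hdot (l2delta i) (l2delta j) = (i == j)%:R :> C.
Proof. by rewrite hdot_delta/= eq_sym. Qed.

(* matrix with respect to the canonical orthonormal basis *)
Definition opmatrix (U : l2 R -> l2 R) (i j : nat) : C :=
  hdot (U (l2delta j)) (l2delta i).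

End canonical_basis.

Definition bounded_operator (R : realType) (V W : normedModType R[i])
    (T : V -> W) : Prop :=
  exists M : R, forall x, rnorm (T x) <= M * rnorm x.

Section conjugate_operator.
Variable R : realType.
Local Notation C := R[i].
Implicit Types c d : l2 R.

Let conj_summable c : square_summable (fun i => (c i)^*).
Proof.
have /square_summableP[M cM] := l2P c; apply/square_summableP; exists M => n.
by under eq_bigr do rewrite rnormJ.
Qed.

Let J c : l2 R := mkl2 (conj_summable c).

Let rnorm_J c : rnorm (J c) = rnorm c.
Proof.
apply/eqP; rewrite -(@eqrXn2 _ 2) ?rnorm_ge0// !l2_rnorm_sqr.
by under eq_fun do rewrite /= rnormJ.
Qed.

(* For every bounded [U], the bounded operator with the entrywise conjugate
   matrix exists. *)
Lemma conj_operator_exists (U : {linear l2 R -> l2 R}) : bounded_operator U ->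
  exists V : {linear l2 R -> l2 R}, bounded_operator V /\
    forall i j, opmatrix V i j = (opmatrix U i j)^*.
Proof.
move=> [M UM]; pose V c := J (U (J c)).
have linV : linear V.
  move=> a c d; apply: l2_ext => i; rewrite /V.
  have -> : J (a *: c + d) = a^* *: J c + J d.
    by apply: l2_ext => k /=; rewrite rmorphD rmorphM.
  rewrite linearP /= -[LHS]/((a^* * U (J c) i + U (J d) i)^*).
  by rewrite rmorphD rmorphM/= conjCK.
pose Vm := GRing.isLinear.Build _ _ _ _ V linV.
pose Vl : {linear l2 R -> l2 R} := HB.pack V Vm.
exists Vl; split.
  by exists M => c; rewrite [Vl c]/(J (U (J c))) rnorm_J -(rnorm_J c).
move=> i j; rewrite /opmatrix !hdot_delta /=; congr ((U _ i)^*).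
by apply: l2_ext => k /=; rewrite conjC_nat.
Qed.

End conjugate_operator.

Definition separable (T : topologicalType) : Prop :=
  exists2 D : set T, countable D & dense D.

Section bases.
Variables (R : realType) (H : hilbertType R).

Definition frame (f : nat -> H) : Prop :=
  exists A B : R, [/\ 0 < A, 0 < B & forall x : H,
    ((A * rnorm x ^+ 2)%:E <= \sum_(0 <= i <oo) (rnorm (hdot x (f i)) ^+ 2)%:E
      <= (B * rnorm x ^+ 2)%:E)%E].

(* range of the adjoint [x |-> (<x, f_i>)_i] of the pre-frame operator *)
Definition adjoint_range (f : nat -> H) : set (l2 R) :=
  [set c | exists x : H, forall i, c i = hdot x (f i)].

Definition closed_span (g : nat -> H) : set H :=
  closure [set x | exists n (a : nat -> R[i]), x = \sum_(i < n) a i *: g i].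

Definition orthonormal_basis (e : nat -> H) : Prop :=
  (forall i j, hdot (e i) (e j) = (i == j)%:R) /\ closed_span e = setT.

(* [T] is a bijection from [K] onto [W] with bounded inverse [S : W -> K]. *)
Definition bounded_invertible_onto (K : hilbertType R) (W : set H)
    (T : {linear K -> H}) : Prop :=
  bounded_operator T /\
  exists S : H -> K,
    [/\ forall x, W (T x), cancel T S, forall y, W y -> T (S y) = y &
        exists M : R, forall y, W y -> rnorm (S y) <= M * rnorm y].

End bases.

(* A Riesz basis here is a Riesz basis of its closed linear span; it need not
   span [H]. *)
Definition riesz_basis (R : realType) (H : hilbertType R) (g : nat -> H) : Prop :=
  exists (K : hilbertType R) (e : nat -> K) (T : {linear K -> H}),
    [/\ orthonormal_basis e, bounded_invertible_onto (closed_span g) T &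
        forall i, g i = T (e i)].

(* Main.v *)
Require Import Defs.
From HB Require Import structures.
From mathcomp Require Import all_boot all_order all_algebra.
From mathcomp Require Import complex lra ring.
From mathcomp Require Import boolp classical_sets functions cardinality reals ereal.
From mathcomp Require Import topology normedtype sequences.

Set Implicit Arguments.
Unset Strict Implicit.
Unset Printing Implicit Defensive.

Import Order.TTheory GRing.Theory Num.Theory.
Import numFieldNormedType.Exports.

Local Open Scope classical_set_scope.
Local Open Scope ring_scope.

(** Let [A x = (<x, f_i>)_i] be the analysis operator of [f].  Reading the
    matrices row by row gives [<x, g_i> = sum_j conj(u_ij) <x, f_j>], so the
    analysis operator of [g] is the bounded operator [Ubar \o A], and the
    surjectivity of [Ubar] on the range of [A] says exactly that [Ubar \o A]
    maps [H] onto [l2]: every square-summable [c] is the moment sequence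
    [(<x, g_i>)_i] of some [x].  It remains to see that this solvability of the
    moment problem characterizes Riesz bases.

    The adjoint of an analysis operator is the synthesis operator
    [D c = sum_i c_i g_i] ([synthesis_exists]); two facts about it give the
    equivalence.

    - [riesz_basisP]: [g] is a Riesz basis of its closed span iff [D] is bounded
      below.  A lower bound makes the range of [D] closed, so [D] itself maps the
      canonical basis of [l2] boundedly and invertibly onto the closed span.
      Conversely, if [g_i = T e_i] with [T] boundedly invertible, the lower bound
      holds on finite sums by orthonormality of [e], hence everywhere by
      continuity.

    - [adjoint_surjP]: a bounded operator is onto iff its adjoint [D] is bounded
      below.  If it is onto, the vectors [c] with [|D c| <= 1] are weakly
      bounded, hence bounded ([weakly_bounded_bounded], the uniform boundedness
      principle).  Conversely, if [D] is bounded below then the composite of the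
      operator with [D] is coercive, and coercive operators are onto
      ([coercive_surj]). *)

(** * Norms, limits and bounded operators *)

Section limits.
Variable R : realType.
Local Notation C := R[i].
Local Notation toC := (real_complex R).

Lemma rnormZ (V : normedModType C) (a : C) (x : V) :
  rnorm (a *: x) = rnorm a * rnorm x.
Proof. by apply: complexI; rewrite rmorphM/= !rnormE normrZ. Qed.

Lemma rnormB (V : normedZmodType C) (x y : V) : rnorm (x - y) = rnorm (y - x).
Proof. by rewrite -rnormN opprB. Qed.

Lemma rnorm_toC (a : R) : rnorm (toC a) = `|a|.
Proof.
by apply: complexI; rewrite rnormE normc_def/= expr0n/= addr0 sqrtr_sqr.
Qed.

Lemma rnorm_cvgP (V : normedModType C) (y : nat -> V) (l : V) :
  y @ \oo --> l <-> (fun n => rnorm (l - y n)) @ \oo --> (0 : R).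
Proof.
split=> [/cvgrPdist_lt yl|/cvgrPdist_lt yl]; apply/cvgrPdist_lt => e.
  move=> e0; have e0' : 0 < toC e by rewrite (_ : 0 = toC 0)// ltcR.
  apply: filterS (yl _ e0') => n; rewrite -rnormE ltcR sub0r normrN.
  by rewrite ger0_norm// rnorm_ge0.
move=> /ReK_gt0[er e0]; apply: filterS (yl _ e0) => n.
by rewrite sub0r normrN ger0_norm ?rnorm_ge0// -er -rnormE ltcR.
Qed.

Lemma cvg_rnorm (V : normedModType C) (y : nat -> V) (l : V) :
  y @ \oo --> l -> (fun n => rnorm (y n)) @ \oo --> rnorm l.
Proof.
move=> /rnorm_cvgP/cvgrPdist_lt yl; apply/cvgrPdist_lt => e /yl.
apply: filterS => n; rewrite sub0r normrN ger0_norm ?rnorm_ge0//.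
exact: le_lt_trans (rnorm_dist _ _).
Qed.

Lemma cvg_rnorm_le (V W : normedModType C) (y : nat -> V) (l : V)
    (z : nat -> W) (k : W) (M : R) : y @ \oo --> l -> z @ \oo --> k ->
  (forall n, rnorm (y n) <= M * rnorm (z n)) -> rnorm l <= M * rnorm k.
Proof.
move=> /cvg_rnorm yl /cvg_rnorm zk yz.
have zk' : (fun n => M * rnorm (z n)) @ \oo --> M * rnorm k.
  by apply: cvgM => //; exact: cvg_cst.
have := ler_lim (cvgP _ yl) (cvgP _ zk').
rewrite (cvg_lim _ yl)// (cvg_lim _ zk')//; apply.
by apply: nearW => n; exact: yz.
Qed.

Lemma rnorm_cauchy_cvg (V : completeNormedModType C) (y : nat -> V) :
  (forall e : R, 0 < e -> exists N, forall n, (N <= n)%N ->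
     rnorm (y n - y N) <= e) -> cvgn y.
Proof.
move=> yN; apply: cauchy_cvg; apply: cauchy_exP => e /ReK_gt0[er e0].
have e20 : 0 < complex.Re e / 2 by rewrite divr_gt0.
have [N hN] := yN _ e20; exists (y N); exists N => // n /= Nn.
rewrite -ball_normE/= -er -rnormE ltcR rnormB (le_lt_trans (hN _ Nn))//.
by rewrite ltr_pdivrMr// ltr_pMr// ltr1n.
Qed.

(** A sequence with geometrically decreasing steps converges, at the rate of
    the tail of the geometric series. *)
Lemma geometric_steps_cvg (V : completeNormedModType C) (y : nat -> V)
    (K q : R) : 0 <= q < 1 -> (forall n, rnorm (y n.+1 - y n) <= K * q ^+ n) ->
  exists2 l, y @ \oo --> l &
    forall n, rnorm (l - y n) <= K / (1 - q) * q ^+ n.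
Proof.
move=> /andP[q0 q1] yK.
have q1' : 0 < 1 - q by rewrite subr_gt0.
have K0 : 0 <= K.
  by have := yK 0%N; rewrite expr0 mulr1; apply: le_trans; exact: rnorm_ge0.
have step n k : rnorm (y (n + k)%N - y n) <= K / (1 - q) * q ^+ n.
  apply: (@le_trans _ _ (K / (1 - q) * (q ^+ n - q ^+ (n + k)))).
    elim: k => [|k IH]; first by rewrite addn0 !subrr rnorm0 mulr0.
    have -> : y (n + k.+1)%N - y n =
        (y (n + k).+1 - y (n + k)%N) + (y (n + k)%N - y n).
      by rewrite addnS addrA subrK.
    rewrite (le_trans (rnormD _ _))// (le_trans (lerD (yK _) IH))//.
    rewrite le_eqVlt; apply/orP; left; apply/eqP; rewrite addnS exprS.
    by field; rewrite gt_eqF.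
  by rewrite ler_wpM2l ?divr_ge0 ?(ltW q1')// gerBl exprn_ge0.
have [l yl] : exists l : V, y @ \oo --> l.
  apply/cvg_ex.
  apply: rnorm_cauchy_cvg => e e0.
  have /cvg_geometric geo : `|q| < 1 by rewrite ger0_norm.
  have /cvgrPdist_lt/(_ _ e0)[N _ /(_ N (leqnn N))] := geo (K / (1 - q)).
  rewrite /geometric/= sub0r normrN => KN; exists N => n /subnKC <-.
  by rewrite (le_trans (step _ _))// (le_trans (ler_norm _))// ltW.
exists l => // n.
have yn : (fun k => y (n + k)%N - y n) @ \oo --> l - y n.
  apply: cvgB; last exact: cvg_cst.
  rewrite (_ : (fun k => _) = [sequence y (k + n)%N]_k) ?cvg_shiftn//.
  by apply/funext => k; rewrite addnC.
have /limr_le := cvgP _ (cvg_rnorm yn); rewrite (cvg_lim _ (cvg_rnorm yn))//.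
by apply; apply: nearW => k; exact: step.
Qed.

Definition bounded_below (V W : normedModType C) (T : V -> W) : Prop :=
  exists M : R, forall x, rnorm x <= M * rnorm (T x).

Lemma positive_bound (X : Type) (V : normedModType C) (F : X -> R)
    (v : X -> V) :
  (exists M : R, forall x, F x <= M * rnorm (v x)) ->
  exists2 M : R, 0 < M & forall x, F x <= M * rnorm (v x).
Proof.
move=> [M FM]; exists (`|M| + 1) => [|x]; first by rewrite ltr_wpDl.
rewrite (le_trans (FM x))// ler_wpM2r ?rnorm_ge0//.
by rewrite (le_trans (ler_norm M))// lerDl.
Qed.

Lemma bounded_operatorP (V W : normedModType C) (T : V -> W) :
  bounded_operator T ->
  exists2 M : R, 0 < M & forall x, rnorm (T x) <= M * rnorm x.
Proof. exact: (@positive_bound _ _ (fun x => rnorm (T x)) id). Qed.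

Lemma bounded_belowP (V W : normedModType C) (T : V -> W) :
  bounded_below T ->
  exists2 M : R, 0 < M & forall x, rnorm x <= M * rnorm (T x).
Proof. exact: (@positive_bound _ _ (fun x => rnorm x) T). Qed.

Lemma bounded_operator_comp (V W X : normedModType C)
    (S : W -> X) (T : V -> W) :
  bounded_operator S -> bounded_operator T -> bounded_operator (S \o T).
Proof.
move=> /bounded_operatorP[M M0 SM] [N TN]; exists (M * N) => x.
by rewrite (le_trans (SM _))// -mulrA ler_wpM2l// ltW.
Qed.

Lemma bounded_operator_cvg (V W : normedModType C) (T : {linear V -> W})
    (y : nat -> V) (l : V) :
  bounded_operator T -> y @ \oo --> l -> (T \o y) @ \oo --> T l.
Proof.
move=> /bounded_operatorP[M M0 TM] /rnorm_cvgP yl; apply/rnorm_cvgP.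
have Myl : (fun n => M * rnorm (l - y n)) @ \oo --> (0 : R).
  by rewrite -(mulr0 M); apply: cvgM => //; exact: cvg_cst.
apply: (squeeze_cvgr _ (cvg_cst 0) Myl).
by apply: nearW => n /=; rewrite rnorm_ge0 -linearB TM.
Qed.

End limits.

(** * Inner products *)

Section hilbert.
Variable R : realType.
Local Notation C := R[i].
Local Notation toC := (real_complex R).
Implicit Types H K : hilbertType R.

Lemma hdotC H (x y : H) : hdot x y = (hdot y x)^*.
Proof. by rewrite (hermC hdot) expr0 mul1r. Qed.

(** The generic bilinearity lemmas leave the scalar field in a form on which
    later rewriting fails; these instances are stated at [R[i]] itself. *)
Lemma hdotDl H (x y z : H) : hdot (x + y) z = hdot x z + hdot y z.
Proof. exact: linearDl. Qed.

Lemma hdotBl H (x y z : H) : hdot (x - y) z = hdot x z - hdot y z.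
Proof. exact: linearBl. Qed.

Lemma hdotBr H (x y z : H) : hdot z (x - y) = hdot z x - hdot z y.
Proof. exact: linearBr. Qed.

Lemma hdotZl H a (x y : H) : hdot (a *: x) y = a * hdot x y.
Proof. exact: linearZl_LR. Qed.

Lemma hdot_rnorm H (x : H) : hdot x x = toC (rnorm x ^+ 2).
Proof. by rewrite hdotE rmorphXn/= rnormE. Qed.

Lemma rnorm_hdot_le H (x y : H) : rnorm (hdot x y) <= rnorm x * rnorm y.
Proof.
rewrite -ler_sqr ?nnegrE ?mulr_ge0 ?rnorm_ge0// -lecR rmorphXn/= rnormE.
by rewrite exprMn rmorphM/= -!hdot_rnorm; exact: dot_cauchy_schwarz.
Qed.

Lemma cvg_hdotl H (y : nat -> H) (l x : H) :
  y @ \oo --> l -> (fun n => hdot (y n) x : C^o) @ \oo --> (hdot l x : C^o).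
Proof.
move=> /rnorm_cvgP yl; apply/(@rnorm_cvgP _ C^o).
have Myl : (fun n => rnorm (l - y n) * rnorm x) @ \oo --> (0 : R).
  by rewrite -(mul0r (rnorm x)); apply: cvgM => //; exact: cvg_cst.
apply: (squeeze_cvgr _ (cvg_cst 0) Myl).
by apply: nearW => n /=; rewrite rnorm_ge0 -hdotBl; exact: rnorm_hdot_le.
Qed.

Lemma hdot_suml H n (v : nat -> H) (a : nat -> C) (m : nat) (x : H) :
  hdot (\sum_(m <= i < n) a i *: v i) x = \sum_(m <= i < n) a i * hdot (v i) x.
Proof. by rewrite linear_sumlz; apply: eq_bigr => i _; exact: linearZl_LR. Qed.

End hilbert.

(** * Operators between Hilbert spaces *)

Section hilbert_operators.
Variable R : realType.
Local Notation C := R[i].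
Local Notation toC := (real_complex R).
Implicit Types H K : hilbertType R.

Lemma rnorm_sqrB H (x y : H) :
  rnorm (x - y) ^+ 2 = rnorm x ^+ 2 - 2 * complex.Re (hdot y x) + rnorm y ^+ 2.
Proof.
have := hdot_rnorm (x - y); rewrite hdotBl !hdotBr.
rewrite !hdot_rnorm (hdotC x y); case: (hdot y x) => a b.
move=> /eqP; rewrite eq_complex /= => /andP[/eqP <- _]; ring.
Qed.

(** The uniform boundedness principle for the functionals [<_, c>], by a gliding
    hump instead of Baire's theorem.  If [P] had elements [a n] of very fast
    growing norm, one could build a convergent sequence [y] whose [n]-th step has
    length at most [3^-n] and makes [|<y, a n>|] at least [3^-n |a n|]; the later
    steps add up to at most half of [3^-n], so the limit is still unbounded
    against [a]. *)
Lemma weakly_bounded_bounded H (P : set H) :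
  (forall y, exists M : R, forall c, P c -> rnorm (hdot y c) <= M) ->
  exists M : R, forall c, P c -> rnorm c <= M.
Proof.
move=> wP; apply: contrapT => /forallNP nP.
have [a aP] : {a : nat -> H & forall n, P (a n) /\ n%:R * 3 ^+ n < rnorm (a n)}.
  apply: (@choice _ _ (fun n c => P c /\ n%:R * 3 ^+ n < rnorm c)) => n.
  have /existsNP[c /not_implyP[Pc cn]] := nP (n%:R * 3 ^+ n).
  by exists c; split => //; rewrite ltNge; apply/negP.
pose q : R := 3^-1.
have q0 : 0 < q by rewrite invr_gt0.
have a0 n : 0 < rnorm (a n).
  by rewrite (le_lt_trans _ (aP n).2)// mulr_ge0// exprn_ge0.
have step (ny : nat * H) : exists z : H, rnorm (z - ny.2) <= 1 * q ^+ ny.1 /\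
    q ^+ ny.1 * rnorm (a ny.1) <= rnorm (hdot z (a ny.1)).
  (* For a vector [d] of length [3^-n] along [a n], the values of [<_, a n>] at
     [y + d] and [y - d] differ by [2 * 3^-n * |a n|]: one of them is large. *)
  case: ny => n y /=; pose t := q ^+ n / rnorm (a n).
  have t0 : 0 <= t by rewrite divr_ge0 ?exprn_ge0 ?ltW.
  pose d := toC t *: a n.
  have dn : rnorm d = 1 * q ^+ n.
    by rewrite rnormZ rnorm_toC ger0_norm// divfK ?mul1r// gt_eqF.
  have da : rnorm (hdot d (a n)) = q ^+ n * rnorm (a n).
    rewrite hdotZl /= rnormM rnorm_toC ger0_norm// hdot_rnorm rnorm_toC.
    rewrite ger0_norm ?exprn_ge0 ?rnorm_ge0// /t expr2 mulrA divfK//.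
    by rewrite gt_eqF.
  have [h|h] := leP (q ^+ n * rnorm (a n)) (rnorm (hdot (y + d) (a n))).
    by exists (y + d); rewrite addrC addKr dn.
  exists (y - d); rewrite addrAC subrr add0r rnormN dn; split => //.
  have := rnormD (hdot (y + d) (a n)) (- hdot (y - d) (a n)).
  have -> : hdot (y + d) (a n) - hdot (y - d) (a n) = toC 2 * hdot d (a n).
    rewrite -hdotBl opprB addrC addrA subrK hdotDl.
    by rewrite rmorph_nat mulr2n mulrDl mul1r.
  rewrite rnormN rnormM rnorm_toC ger0_norm// da.
  by move: h; move: (rnorm _) (rnorm _) (_ * _) => u v w; lra.
have [z zP] := choice step.
pose y := fix y n := if n is p.+1 then z (p, y p) else 0.
have yP n : rnorm (y n.+1 - y n) <= 1 * q ^+ n by case: (zP (n, y n)).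
have q01 : 0 <= q < 1 by rewrite ltW// invf_lt1// ltr1n.
have [l _ yl] := geometric_steps_cvg q01 yP.
have [M lM] := wP l.
have {}lM n : n%:R < 2 * M.
  have [Pa an] := aP n; have := lM _ Pa.
  have [_ /= yn] := zP (n, y n); rewrite -[z _]/(y n.+1) in yn.
  have := le_trans (rnorm_hdot_le (l - y n.+1) (a n))
    (ler_wpM2r (rnorm_ge0 _) (yl n.+1)).
  have := rnorm_dist (hdot (y n.+1) (a n)) (hdot l (a n)).
  rewrite -hdotBl hdotBl rnormB -hdotBl.
  move=> /ler_normlP[_ h1] h2 h3.
  have -> : n%:R = q ^+ n * (n%:R * 3 ^+ n).
    by rewrite mulrCA -exprMn mulVf ?pnatr_eq0// expr1n mulr1.
  have : q ^+ n * (n%:R * 3 ^+ n) < q ^+ n * rnorm (a n).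
    by rewrite ltr_pM2l// exprn_gt0.
  move: h2; rewrite exprS.
  have -> : 1 / (1 - q) * (q * q ^+ n) * rnorm (a n) =
            q ^+ n * rnorm (a n) / 2 by rewrite /q; field.
  move: yn h1 h3.
  by move: (q ^+ n * rnorm (a n)) (q ^+ n * (n%:R * 3 ^+ n)) => *; lra.
have := lM (Num.truncn (2 * M)).+1.
by apply/negP; rewrite -leNgt ltW// truncnS_gt.
Qed.

(** Lax-Milgram by Richardson iteration: for a small step [a], the residual map
    [r = id - a B] is a contraction, as
    [|r c|^2 <= (1 - 2 a m + a^2 M^2) |c|^2] when [M] bounds [B]. *)
Lemma coercive_surj K (B : {linear K -> K}) (m : R) : 0 < m ->
  bounded_operator B ->
  (forall c, m * rnorm c ^+ 2 <= complex.Re (hdot (B c) c)) ->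
  forall y, exists c, B c = y.
Proof.
move=> m0 /bounded_operatorP[M M0 BM] Bm y.
have mM0 : 0 < M + m by rewrite addr_gt0.
(* The optimal step is [m / M ^+ 2]; enlarging [M] to [M + m] forces
   [a * m < 1], so that the contraction rate has a real square root. *)
pose a := m / (M + m) ^+ 2.
have a0 : 0 < a by rewrite divr_gt0// exprn_gt0.
pose q2 := 1 - a * m.
have am : a * m = (m / (M + m)) ^+ 2 by rewrite /a; field; rewrite gt_eqF.
have q2_lt1 : q2 < 1 by rewrite gtrBl mulr_gt0.
have q2_ge0 : 0 <= q2.
  rewrite subr_ge0 am exprn_ile1 ?divr_ge0 ?ltW//.
  by rewrite ltr_pdivrMr// mul1r ltrDr.
pose r c := c - toC a *: B c.
have rq c : rnorm (r c) <= Num.sqrt q2 * rnorm c.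
  rewrite -ler_sqr ?nnegrE ?mulr_ge0 ?rnorm_ge0 ?sqrtr_ge0//.
  rewrite exprMn sqr_sqrtr// rnorm_sqrB hdotZl /= rnormZ rnorm_toC.
  have -> : complex.Re (toC a * hdot (B c) c) = a * complex.Re (hdot (B c) c).
    by case: (hdot (B c) c) => ? ? /=; rewrite mul0r subr0.
  rewrite (ger0_norm (ltW a0)) exprMn.
  have h1 : a * (m * rnorm c ^+ 2) <= a * complex.Re (hdot (B c) c).
    by rewrite ler_pM2l.
  have h2 : a ^+ 2 * rnorm (B c) ^+ 2 <= a * m * rnorm c ^+ 2.
    have -> : a * m * rnorm c ^+ 2 = a ^+ 2 * ((M + m) * rnorm c) ^+ 2.
      by rewrite /a; field; rewrite gt_eqF.
    rewrite ler_pM2l ?exprn_gt0//.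
    rewrite ler_sqr ?nnegrE ?mulr_ge0 ?rnorm_ge0 ?(ltW mM0)//.
    by rewrite (le_trans (BM c))// ler_wpM2r ?rnorm_ge0// lerDl ltW.
  rewrite /q2; lra.
pose x := fix x n := if n is p.+1 then x p + toC a *: (y - B (x p)) else 0.
have xS n : x n.+1 - x n = toC a *: (y - B (x n)) by rewrite /= addrC addKr.
have xr n : rnorm (x n.+1 - x n) <= rnorm (x 1%N - x 0%N) * Num.sqrt q2 ^+ n.
  elim: n => [|n IH]; first by rewrite expr0 mulr1.
  have -> : x n.+2 - x n.+1 = r (x n.+1 - x n).
    rewrite /r linearB xS [X in _ = X - _]xS -scalerBr; congr (_ *: _).
    by rewrite opprB addrA subrK.
  rewrite (le_trans (rq _))// exprS mulrCA ler_wpM2l ?sqrtr_ge0//.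
have q01 : 0 <= Num.sqrt q2 < 1.
  by rewrite sqrtr_ge0 -[ltRHS]sqrtr1 ltr_sqrt.
have [l xl _] := geometric_steps_cvg q01 xr.
exists l; have xl1 : (fun n => x n.+1 - x n) @ \oo --> l - l.
  by apply: cvgB => //; rewrite (cvg_shiftS x).
(* The steps tend to [0], and they are multiples of the defects
   [y - B (x n)]. *)
have xl2 : (fun n => x n.+1 - x n) @ \oo --> toC a *: (y - B l).
  under eq_fun do rewrite xS.
  apply: (@cvgZl_tmp _ _ _ _ _ (toC a)); apply: cvgB; first exact: cvg_cst.
  apply: bounded_operator_cvg => //; by exists M.
have : l - l = toC a *: (y - B l) by exact: (norm_cvg_unique xl1 xl2).
move/esym/eqP; rewrite subrr.
rewrite scaler_eq0 subr_eq0 => /orP[|/eqP//].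
by rewrite (_ : 0 = toC 0)// (inj_eq (@complexI _)) gt_eqF.
Qed.

(** If [A] is onto, then for [|D c| <= 1] each functional value
    [<A x, c> = <x, D c>] is at most [|x|], so these [c] are weakly bounded.  In
    the other direction [<A (D c), c> = |D c|^2] makes [A \o D] coercive. *)
Lemma adjoint_surjP H K (A : {linear H -> K}) (D : {linear K -> H}) :
  bounded_operator A -> bounded_operator D ->
  (forall x c, hdot (A x) c = hdot x (D c)) ->
  (forall c, exists x, A x = c) <-> bounded_below D.
Proof.
move=> bA bD AD; split=> [surjA|/bounded_belowP[M M0 DM] c].
  have [y|M PM] := @weakly_bounded_bounded K [set c | rnorm (D c) <= 1].
    have [x <-] := surjA y; exists (rnorm x) => c /= Dc.
    by rewrite AD (le_trans (rnorm_hdot_le _ _))// ler_piMr ?rnorm_ge0.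
  have M0 : 0 <= M.
    by rewrite (le_trans (rnorm_ge0 (0 : K)))// PM//= linear0 rnorm0.
  (* [D c] may vanish, so [c] is normalized by a number slightly above
     [|D c|]. *)
  exists M => c; apply/ler_addgt0Pr => e e0.
  pose s := rnorm (D c) + e / (M + 1).
  have s0 : 0 < s by rewrite ltr_wpDl ?rnorm_ge0// divr_gt0// ltr_wpDl.
  have : rnorm (toC s^-1 *: c) <= M.
    apply: PM; rewrite /= linearZ /= rnormZ rnorm_toC gtr0_norm ?invr_gt0//.
    by rewrite ler_pdivrMl// mulr1 lerDl divr_ge0 ?ltW// ltr_wpDl.
  rewrite rnormZ rnorm_toC gtr0_norm ?invr_gt0// ler_pdivrMl// mulrC.
  move=> /le_trans; apply; rewrite mulrDr lerD2l mulrCA ler_piMr ?(ltW e0)//.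
  by rewrite ler_pdivrMr ?mul1r ?lerDl// ltr_wpDl.
have bAD : bounded_operator (A \o D) by exact: bounded_operator_comp.
have [|c'|d <-] := @coercive_surj K (A \o D) (M ^- 2) _ bAD _ c.
- by rewrite invr_gt0 exprn_gt0.
- rewrite /= AD hdot_rnorm /= ler_pdivrMl ?exprn_gt0// -exprMn.
  by rewrite ler_sqr ?nnegrE ?mulr_ge0 ?rnorm_ge0 ?(ltW M0).
- by exists (D d).
Qed.

(** A sequence of images converging to [y] at rate [2^-n] has, by the lower
    bound, preimages with geometrically small steps; these converge. *)
Lemma bounded_below_closed_range H K (D : {linear K -> H}) :
  bounded_operator D -> bounded_below D -> closure (range D) `<=` range D.
Proof.
move=> bD /bounded_belowP[M M0 DM] y cDy.
have e0 n : 0 < (2^-1 : R) ^+ n by rewrite exprn_gt0// invr_gt0.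
have [c yc] : {c : nat -> K & forall n, rnorm (y - D (c n)) < 2^-1 ^+ n}.
  apply: (@choice _ _ (fun n c => rnorm (y - D c) < 2^-1 ^+ n)) => n.
  have /cDy[_ [[c _ <-]]] : nbhs y (ball y (toC (2^-1 ^+ n))).
    by apply: nbhsx_ballx; rewrite (_ : 0 = toC 0)// ltcR.
  by rewrite -ball_normE /= -rnormE ltcR => yc; exists c.
have cS n : rnorm (c n.+1 - c n) <= 2 * M * 2^-1 ^+ n.
  rewrite (le_trans (DM _))// [2 * M]mulrC -mulrA ler_pM2l// linearB /=.
  rewrite -(subrKA y) (le_trans (rnormD _ _))// rnormB.
  rewrite (_ : 2 * _ = 2^-1 ^+ n + 2^-1 ^+ n); last first.
    by rewrite mulr2n mulrDl mul1r.
  rewrite lerD ?(ltW (yc _))// (le_trans (ltW (yc _)))//.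
  rewrite exprS ler_piMl ?(ltW (e0 _))//.
  by rewrite invf_le1// ler1n.
have q01 : 0 <= (2^-1 : R) < 1 by rewrite invr_ge0 ler0n/= invf_lt1// ltr1n.
have [l cl _] := geometric_steps_cvg q01 cS.
exists l => //; apply: (@norm_cvg_unique _ _ ((D \o c) @ \oo)) => //.
  exact: bounded_operator_cvg.
apply/rnorm_cvgP.
have geo : (fun n => (2^-1 : R) ^+ n) @ \oo --> (0 : R).
  by apply: cvg_expr; rewrite ger0_norm ?invr_ge0// invf_lt1// ltr1n.
apply: (squeeze_cvgr _ (cvg_cst 0) geo).
by apply: nearW => n /=; rewrite rnorm_ge0 ltW.
Qed.

End hilbert_operators.

(** * Analysis and synthesis operators *)

Section sequences_in_hilbert.
Variable R : realType.
Local Notation C := R[i].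
Local Notation toC := (real_complex R).
Implicit Types H K : hilbertType R.

Lemma hdot_inj H (u v : H) : (forall x, hdot u x = hdot v x) -> u = v.
Proof.
move=> uv; apply/eqP; rewrite -subr_eq0 -normr_eq0 -sqrf_eq0 -hdotE.
by rewrite hdotBl uv subrr.
Qed.

Lemma rnorm_orthonormal_sum H (e : nat -> H) (a : nat -> C) n :
  (forall i j, hdot (e i) (e j) = (i == j)%:R) ->
  rnorm (\sum_(0 <= i < n) a i *: e i) ^+ 2 =
  \sum_(0 <= i < n) rnorm (a i) ^+ 2.
Proof.
move=> eo; apply: complexI; rewrite -hdot_rnorm hdot_suml rmorph_sum/=.
apply: eq_big_nat => i /andP[_ ni]; rewrite rnorm_sqr; congr (_ * _).
rewrite hdotC hdot_suml (bigD1_seq i) ?mem_index_iota ?iota_uniq//=.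
rewrite eo eqxx mulr1 big1 ?addr0// => j /negbTE ji.
by rewrite eo ji mulr0.
Qed.

Lemma hdot_l2delta i (c : l2 R) : hdot (l2delta R i) c = (c i)^*.
Proof. by rewrite hdotC hdot_delta. Qed.

(** Pythagoras: the squared distance from [c] to its [n]-th partial sum [s n] is
    [|c|^2] minus the [n]-th partial sum of [|c_i|^2], because [<s n, c>] and
    [|s n|^2] are both that partial sum. *)
Lemma l2_expansion (c : l2 R) :
  series (fun i => c i *: l2delta R i) @ \oo --> c.
Proof.
pose s n := series (fun i => c i *: l2delta R i) n.
have sn n : rnorm (c - s n) ^+ 2 =
    rnorm c ^+ 2 - series (fun i => rnorm (c i) ^+ 2) n.
  rewrite rnorm_sqrB rnorm_orthonormal_sum; last exact: l2delta_orthonormal.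
  have -> : hdot (s n) c = toC (series (fun i => rnorm (c i) ^+ 2) n).
    rewrite hdot_suml rmorph_sum/=; apply: eq_bigr => i _.
    by rewrite hdot_l2delta rnorm_sqr.
  rewrite /= /series/=; ring.
have cv : series (fun i => rnorm (c i) ^+ 2) @ \oo --> rnorm c ^+ 2.
  by rewrite l2_rnorm_sqr; exact: square_summable_cvg (l2P c).
apply/rnorm_cvgP/cvgrPdist_lt => e e0.
have /cvgrPdist_lt/(_ (e ^+ 2)) := cv; rewrite exprn_gt0// => /(_ isT).
apply: filterS => n; rewrite -sn sub0r normrN => h.
rewrite -ltr_sqr ?nnegrE ?(ltW e0)// ger0_norm ?rnorm_ge0//.
by rewrite ger0_norm ?exprn_ge0 ?rnorm_ge0 in h.
Qed.

Arguments l2_expansion : clear implicits.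

Definition analysis_of H (g : nat -> H) (A : H -> l2 R) : Prop :=
  forall x i, A x i = hdot x (g i).

Lemma hdot_sum_analysis H (g : nat -> H) (A : H -> l2 R) (a : nat -> C) m n x :
  analysis_of g A ->
  hdot (\sum_(m <= i < n) a i *: g i) x =
  hdot (\sum_(m <= i < n) a i *: l2delta R i) (A x).
Proof.
move=> gA; rewrite !hdot_suml; apply: eq_bigr => i _.
by rewrite hdot_l2delta gA -hdotC.
Qed.

(** A vector [v] with [<v, x> = <c, A x>] is the value at [c] of an adjoint of
    [A]; testing at [x = v] bounds it, before any adjoint has been built. *)
Lemma adjoint_bound H K (A : H -> K) (M : R) (v : H) (c : K) :
  0 <= M -> (forall x, rnorm (A x) <= M * rnorm x) ->
  (forall x, hdot v x = hdot c (A x)) -> rnorm v <= M * rnorm c.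
Proof.
move=> M0 AM vc; have := rnorm_ge0 v.
rewrite le_eqVlt => /predU1P[<-|v0]; first by rewrite mulr_ge0 ?rnorm_ge0.
rewrite -(ler_pM2r v0) -expr2 -[leLHS]ger0_norm ?exprn_ge0 ?rnorm_ge0//.
rewrite -rnorm_toC -hdot_rnorm vc (le_trans (rnorm_hdot_le _ _))//.
by rewrite mulrAC [leRHS]mulrC ler_wpM2l ?rnorm_ge0.
Qed.

(** The synthesis operator is the adjoint of the analysis operator.  On finite
    sums the adjoint relation is an identity ([hdot_sum_analysis]); it bounds the
    blocks of the series by the tails of the expansion of [c], which gives
    convergence, and passing to the limit gives the relation everywhere.
    Linearity and boundedness follow from that relation. *)
Lemma synthesis_exists H (g : nat -> H) (A : H -> l2 R) :
  bounded_operator A -> analysis_of g A ->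
  exists D : {linear l2 R -> H}, [/\ bounded_operator D,
    forall x c, hdot (A x) c = hdot x (D c) &
    forall c : l2 R, series (fun i => c i *: g i) @ \oo --> D c].
Proof.
move=> /bounded_operatorP[M M0 AM] gA.
have cvg_syn (c : l2 R) : cvgn (series (fun i => c i *: g i)).
  apply: rnorm_cauchy_cvg => e e0.
  have e0' : 0 < e / M / 2 by rewrite !divr_gt0.
  have /rnorm_cvgP/cvgrPdist_lt/(_ _ e0')[N _ Ne] := l2_expansion c.
  have {}Ne n : (N <= n)%N ->
      rnorm (c - series (fun i => c i *: l2delta R i) n) <= e / M / 2.
    by move=> /Ne; rewrite sub0r normrN ger0_norm ?rnorm_ge0// => /ltW.
  exists N => n Nn; rewrite sub_series_geq//.
  have adj x := hdot_sum_analysis c N n x gA.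
  rewrite (le_trans (adjoint_bound (ltW M0) AM adj))//.
  rewrite -ler_pdivlMl// mulrC -sub_series_geq// -(subrKA c).
  by rewrite (le_trans (rnormD _ _))// rnormB [leRHS]splitr lerD ?Ne.
pose D (c : l2 R) := limn (series (fun i => c i *: g i)).
have DA c x : hdot (D c) x = hdot c (A x).
  have h1 := @cvg_hdotl _ _ _ _ x (cvg_syn c).
  have h2 := @cvg_hdotl _ _ _ _ (A x) (l2_expansion c).
  apply: (@norm_cvg_unique _ C^o _ _ _ _ h1).
  rewrite (_ : (fun n => _) = (fun n =>
    hdot (series (fun i => c i *: l2delta R i) n) (A x)))//.
  by apply/funext => n; exact: hdot_sum_analysis.
have linD : linear D.
  move=> a c d; apply: hdot_inj => x.
  by rewrite hdotDl hdotZl !DA hdotDl hdotZl.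
pose Dm := GRing.isLinear.Build _ _ _ _ D linD.
pose Dl : {linear l2 R -> H} := HB.pack D Dm.
exists Dl; split => [|x c|//].
  by exists M => c; exact: (adjoint_bound (ltW M0) AM (DA c)).
by rewrite hdotC [RHS]hdotC DA.
Qed.

Lemma l2delta_total : closed_span (@l2delta R) = setT.
Proof.
rewrite -subTset => c _ B /(l2_expansion c)[N _ /(_ N (leqnn N)) BN].
exists (series (fun i => c i *: l2delta R i) N); split => //.
by exists N, c; rewrite /series/= big_mkord.
Qed.

(** * Riesz bases *)

(** The synthesis operator sends the canonical basis of [l2] to [g], so once it
    has a lower bound it is itself the operator that a Riesz basis requires. *)
Lemma riesz_basisP H (g : nat -> H) (D : {linear l2 R -> H}) :
  bounded_operator D ->
  (forall c : l2 R, series (fun i => c i *: g i) @ \oo --> D c) ->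
  riesz_basis g <-> bounded_below D.
Proof.
move=> bD Dg; split=> [[K [e [T [[eo _] [_ [S [TW TK _ [M SM]]]] gT]]]]|Db].
  (* On finite sums the bound is that of [S]: [|sum c_i e_i|] and
     [|sum c_i delta_i|] agree by orthonormality. *)
  exists M => c; apply: (cvg_rnorm_le (l2_expansion c) (Dg c)) => n.
  have gn : series (fun i => c i *: g i) n = T (\sum_(0 <= i < n) c i *: e i).
    by rewrite linear_sum; apply: eq_bigr => i _; rewrite linearZ/= gT.
  have := SM _ (TW (\sum_(0 <= i < n) c i *: e i)); rewrite TK -gn.
  suff -> : rnorm (\sum_(0 <= i < n) c i *: e i) =
      rnorm (series (fun i => c i *: l2delta R i) n) by [].
  apply/eqP; rewrite -(@eqrXn2 _ 2) ?rnorm_ge0// !rnorm_orthonormal_sum//.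
  exact: l2delta_orthonormal.
have Dd i : D (l2delta R i) = g i.
  apply: (norm_cvg_unique (Dg _)); apply: cvg_near_cst.
  exists i.+1 => // n /= ni.
  rewrite /series/= (bigD1_seq i) ?mem_index_iota ?iota_uniq//= eqxx scale1r.
  by rewrite big1 ?addr0// => j /negbTE ji; rewrite ji scale0r.
have DW c : closed_span g (D c).
  move=> B /(Dg c)[N _ /(_ N (leqnn N)) BN].
  exists (series (fun i => c i *: g i) N); split => //.
  by exists N, c; rewrite /series/= big_mkord.
have WD y : closed_span g y -> exists c, D c = y.
  have gD : [set x | exists n (a : nat -> C), x = \sum_(i < n) a i *: g i]
      `<=` range D.
    move=> _ [n [a ->]]; exists (\sum_(i < n) a i *: l2delta R i) => //.
    by rewrite linear_sum; apply: eq_bigr => i _; rewrite linearZ/= Dd.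
  move=> /(closure_subset gD)/(bounded_below_closed_range bD Db)[c _ <-].
  by exists c.
have [M M0 DM] := bounded_belowP Db.
have Dinj : injective D.
  move=> c d cd; apply/eqP; rewrite -subr_eq0 -normr_eq0 -rnormE.
  rewrite (_ : rnorm _ = 0)//; apply/eqP; rewrite eq_le rnorm_ge0 andbT.
  by rewrite (le_trans (DM _))// linearB/= cd subrr rnorm0 mulr0.
pose S y := xget 0 [set c | D c = y].
have DS y : closed_span g y -> D (S y) = y.
  move=> /WD[c cy]; rewrite /S.
  by apply: (@xgetPex _ 0 [set c | D c = y]); exists c.
exists (l2 R), (@l2delta R), D; split => //.
  by split; [exact: l2delta_orthonormal | exact: l2delta_total].
split => //; exists S; split => //.
  by move=> c; apply: Dinj; exact: DS.
by exists M => y Wy; rewrite -{2}(DS y Wy).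
Qed.

(** * Frames and matrices *)

Lemma frame_analysis H (f : nat -> H) : frame f ->
  exists2 A : {linear H -> l2 R}, bounded_operator A & analysis_of f A.
Proof.
move=> [a [B [_ B0 fB]]].
have fx x n : \sum_(0 <= i < n) rnorm (hdot x (f i)) ^+ 2 <= B * rnorm x ^+ 2.
  have /andP[_] := fB x; rewrite -lee_fin -sumEFin; apply: le_trans.
  by apply: nneseries_lim_ge => i _; rewrite lee_fin exprn_ge0// rnorm_ge0.
have fs x : square_summable (fun i => hdot x (f i)).
  by apply/square_summableP; exists (B * rnorm x ^+ 2).
pose A x := mkl2 (fs x).
have linA : linear A.
  by move=> k x y; apply: l2_ext => i; rewrite l2D l2Z /= hdotDl hdotZl.
pose Am := GRing.isLinear.Build _ _ _ _ A linA.
pose Al : {linear H -> l2 R} := HB.pack A Am.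
exists Al => //; exists (Num.sqrt B) => x; apply: l2_norm_le.
  by rewrite mulr_ge0 ?sqrtr_ge0 ?rnorm_ge0.
by move=> n; rewrite exprMn sqr_sqrtr ?(ltW B0)//; exact: fx.
Qed.

(** Applying [U] to the conjugate of a row cut off at [n] produces, in coordinate
    [i], the sum [s] of the first [n] terms [|u_ij|^2], while the cut-off row has
    norm [sqrt s]; hence [s <= M * sqrt s]. *)
Lemma opmatrix_row_summable (U : {linear l2 R -> l2 R}) i :
  bounded_operator U -> square_summable (opmatrix U i).
Proof.
move=> /bounded_operatorP[M M0 UM]; apply/square_summableP.
exists (M ^+ 2) => n; set s := \sum_(0 <= j < n) _.
have s0 : 0 <= s by apply: sumr_ge0 => j _; rewrite exprn_ge0 ?rnorm_ge0.
pose c : l2 R := \sum_(0 <= j < n) (opmatrix U i j)^* *: l2delta R j.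
have cs : rnorm c ^+ 2 = s.
  rewrite rnorm_orthonormal_sum; last exact: l2delta_orthonormal.
  by apply: eq_bigr => j _; rewrite rnormJ.
have Uc : U c i = toC s.
  rewrite -hdot_delta linear_sum/= rmorph_sum/=.
  rewrite (eq_bigr (fun j => (opmatrix U i j)^* *: U (l2delta R j)));
    last first.
    by move=> j _; rewrite linearZ.
  by rewrite hdot_suml; apply: eq_bigr => j _; rewrite rnorm_sqr mulrC.
have sM : s <= M * rnorm c.
  rewrite -[leLHS]ger0_norm// -rnorm_toC -Uc.
  by rewrite (le_trans (l2_coord_le _ _)).
rewrite -cs ler_sqr ?nnegrE ?rnorm_ge0 ?(ltW M0)//.
have := rnorm_ge0 c; rewrite le_eqVlt => /predU1P[<-|c0]; first exact: ltW.
by rewrite -(ler_pM2r c0) -expr2 cs.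
Qed.

(** Both sides are continuous in [c] and agree on the canonical basis. *)
Lemma bounded_operator_coord (V : {linear l2 R -> l2 R}) (r : l2 R) i :
  bounded_operator V -> (forall j, opmatrix V i j = (r j)^*) ->
  forall c, V c i = hdot c r.
Proof.
move=> bV Vr c.
have Vc := bounded_operator_cvg bV (l2_expansion c).
have h1 := @cvg_hdotl _ _ _ _ (l2delta R i) Vc.
have h2 := @cvg_hdotl _ _ _ _ r (l2_expansion c).
rewrite -hdot_delta; apply: (@norm_cvg_unique _ C^o _ _ _ _ h1).
rewrite (_ : (fun n => _) = (fun n =>
  hdot (series (fun i => c i *: l2delta R i) n) r))//.
apply/funext => n /=; rewrite linear_sum/=.
rewrite (eq_bigr (fun j => c j *: V (l2delta R j))); last first.
  by move=> j _; rewrite linearZ.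
rewrite !hdot_suml; apply: eq_bigr => j _.
by rewrite -[hdot (V _) _]/(opmatrix V i j) Vr hdot_l2delta.
Qed.

End sequences_in_hilbert.

Theorem proposition3 (R : realType) (H : hilbertType R)
    (f : nat -> H) (U Ubar : {linear l2 R -> l2 R})
    (u : nat -> nat -> R[i]) (g : nat -> H)
    (H_separable : separable H)
    (f_frame : frame f)
    (U_bounded : bounded_operator U)
    (U_matrix : forall i j, opmatrix U i j = u i j)
    (Ubar_bounded : bounded_operator Ubar)
    (Ubar_matrix : forall i j, opmatrix Ubar i j = (u i j)^*)
    (g_def : forall i, g i = limn (series (fun j => u i j *: f j))) :
  riesz_basis g <-> set_surj (adjoint_range f) [set: l2 R] Ubar.
Proof.
have us i : square_summable (u i).
  have <- : opmatrix U i = u i by apply: funext => j; exact: U_matrix.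
  exact: opmatrix_row_summable.
pose r i := mkl2 (us i).
have [A bA fA] := frame_analysis f_frame.
have [D [_ AD Df]] := synthesis_exists bA fA.
have gr i : g i = D (r i).
  by rewrite g_def; apply/cvg_lim => //; exact: (Df (r i)).
have gA : analysis_of g (Ubar \o A).
  move=> x i /=; rewrite gr -AD.
  exact: (@bounded_operator_coord _ Ubar (r i) i Ubar_bounded (Ubar_matrix i)).
have bUA : bounded_operator (Ubar \o A) by exact: bounded_operator_comp.
have [Dg [bDg ADg Dgg]] := synthesis_exists bUA gA.
have -> : set_surj (adjoint_range f) [set: l2 R] Ubar <->
    (forall c, exists x, (Ubar \o A) x = c).
  split=> [surj c|surj c _].
    have [d [x xd] <-] := surj c I; exists x.
    by congr (Ubar _); apply: l2_ext => i; rewrite xd fA.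
  by have [x <-] := surj c; exists (A x) => //; exists x => i; rewrite fA.
by rewrite (riesz_basisP bDg Dgg) (adjoint_surjP bUA bDg ADg).
Qed.
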